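(* Let $D$ be a 0-dialgebra over a field of characteristic not $2$. Assume that $D$ is semiprime and that all its dialgebra associators $(x,y,z)_\dashv$, $(x,y,z)_\times$, $(x,y,z)_\vdash$ ($x,y,z\in D$) lie in the associative di-nucleus $\mathrm{N}(D)$. Then $D$ is an associative dialgebra.
   Context: A dialgebra is a vector space $D$ with two bilinear operations $\dashv,\vdash\colon D\times D\to D$ (the left and right products). A 0-dialgebra is a dialgebra satisfying the bar identities $(x\dashv y)\vdash z = (x\vdash y)\vdash z$ and $x\dashv(y\dashv z) = x\dashv(y\vdash z)$ for all $x,y,z$. The left, inner and right associators (the dialgebra associators) are $(x,y,z)_\dashv = (x\dashv y)\dashv z - x\dashv(y\dashv z)$, $(x,y,z)_\times = (x\vdash y)\dashv z - x\vdash(y\dashv z)$, $(x,y,z)_\vdash = (x\vdash y)\vdash z - x\vdash(y\vdash z)$. An associative dialgebra is a 0-dialgebra in which all three of these associators vanish identically. The associative di-nucleus $\mathrm{N}(D)$ of a 0-dialgebra $D$ is the set of all $a\in D$ such that $(a,x,y)_\star = (x,a,y)_\star = (x,y,a)_\star = 0$ for all $x,y\in D$ and all $\star\in\{\dashv,\times,\vdash\}$. A di-ideal of a dialgebra $D$ is a subspace $I$ such that $I\dashv D$, $I\vdash D$, $D\dashv I$, $D\vdash I\subseteq I$. A dialgebra is semiprime if for every di-ideal $I$, the condition $I\dashv I = I\vdash I = 0$ implies $I=0$. *)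

(* Defs.v *)
From HB Require Import structures.
From mathcomp Require Import all_boot all_order all_algebra.
From mathcomp Require Import boolp classical_sets.

Set Implicit Arguments.
Unset Strict Implicit.
Unset Printing Implicit Defensive.

Import GRing.Theory.

Local Open Scope ring_scope.
Local Open Scope classical_set_scope.

(* The underlying vector space may be infinite-dimensional. *)
Record dialgebra (F : fieldType) := Dialgebra {
  dialgebra_space :> lmodType F;
  lprod : {bilinear dialgebra_space -> dialgebra_space -> dialgebra_space};
  rprod : {bilinear dialgebra_space -> dialgebra_space -> dialgebra_space}
}.

Declare Scope dialgebra_scope.
Notation "x ⊣ y" := (lprod _ x y)
  (at level 40, left associativity) : dialgebra_scope.
Notation "x ⊢ y" := (rprod _ x y)
  (at level 40, left associativity) : dialgebra_scope.
Local Open Scope dialgebra_scope.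

Definition zero_dialgebra (F : fieldType) (D : dialgebra F) : Prop :=
  (forall x y z : D, (x ⊣ y) ⊢ z = (x ⊢ y) ⊢ z) /\
  (forall x y z : D, x ⊣ (y ⊣ z) = x ⊣ (y ⊢ z)).

Variant assoc_kind := LeftAssoc | InnerAssoc | RightAssoc.

Definition associator (F : fieldType) (D : dialgebra F) (k : assoc_kind)
    (x y z : D) : D :=
  match k with
  | LeftAssoc  => (x ⊣ y) ⊣ z - x ⊣ (y ⊣ z)
  | InnerAssoc => (x ⊢ y) ⊣ z - x ⊢ (y ⊣ z)
  | RightAssoc => (x ⊢ y) ⊢ z - x ⊢ (y ⊢ z)
  end.
Arguments associator {F} D k x y z.

Definition associative_dialgebra (F : fieldType) (D : dialgebra F) : Prop :=
  zero_dialgebra D /\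
  forall (k : assoc_kind) (x y z : D), associator D k x y z = 0.

Definition dinucleus (F : fieldType) (D : dialgebra F) : set D :=
  [set a | forall (k : assoc_kind) (x y : D),
     [/\ associator D k a x y = 0,
         associator D k x a y = 0 &
         associator D k x y a = 0]].
Arguments dinucleus {F} D _.

Definition di_ideal (F : fieldType) (D : dialgebra F) (I : set D) : Prop :=
  submod_closed (mem I) /\
  forall a x : D, I a -> [/\ I (a ⊣ x), I (a ⊢ x), I (x ⊣ a) & I (x ⊢ a)].

(* The products of subspaces I ⊣ I and I ⊢ I vanish iff all products of two
   elements of I do, whether or not one takes linear spans. *)
Definition semiprime_dialgebra (F : fieldType) (D : dialgebra F) : Prop :=
  forall I : set D, di_ideal I ->
    (forall a b : D, I a -> I b -> a ⊣ b = 0) ->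
    (forall a b : D, I a -> I b -> a ⊢ b = 0) ->
    I = [set 0].

(* Main.v *)
Require Import Defs.
From HB Require Import structures.
From mathcomp Require Import all_boot all_order all_algebra.
From mathcomp Require Import boolp classical_sets.

(** In a nonassociative algebra whose associators lie in the nucleus, the
    Teichmüller identity shows that [(w(x,y,z),r,s)] is both [cd] and [-cd] with
    [c = (w,x,y)] and [d = (z,r,s)]; away from characteristic 2 the product of
    two associators therefore vanishes, and so does the square of the ideal they
    generate.  A 0-dialgebra [D] is reduced to this case through the
    nonassociative algebra on [D * D] with product
    [(a, u)(b, v) = (a ⊢ b, a ⊢ v + u ⊣ b)]: the bar identities say that the
    factor away from the center only matters through its action, and the three
    dialgebra associators become the second components of ordinary associators,
    according to the argument taken in the second summand. *)

Local Open Scope ring_scope.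
Import GRing.Theory.

Set Implicit Arguments.
Unset Strict Implicit.

(** * Algebras whose associators lie in the nucleus *)

Section AssociatorIdeal.

Variables (F : fieldType) (V : lmodType F) (m : {bilinear V -> V -> V}).

Local Notation "x · y" := (m x y) (at level 40, left associativity).

Definition alg_assoc (x y z : V) : V := (x · y) · z - x · (y · z).

Local Notation "⟨ x , y , z ⟩" := (alg_assoc x y z)
  (at level 0, x, y, z at level 99).

Definition in_nucleus (n : V) : Prop :=
  forall x y, [/\ ⟨n, x, y⟩ = 0, ⟨x, n, y⟩ = 0 & ⟨x, y, n⟩ = 0].

Lemma alg_assocD1 u v x y : ⟨u + v, x, y⟩ = ⟨u, x, y⟩ + ⟨v, x, y⟩.
Proof. by rewrite /alg_assoc !linearDl opprD addrACA. Qed.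

Lemma alg_assocD2 x u v y : ⟨x, u + v, y⟩ = ⟨x, u, y⟩ + ⟨x, v, y⟩.
Proof. by rewrite /alg_assoc linearDr !linearDl linearDr opprD addrACA. Qed.

Lemma alg_assocD3 x y u v : ⟨x, y, u + v⟩ = ⟨x, y, u⟩ + ⟨x, y, v⟩.
Proof. by rewrite /alg_assoc !linearDr opprD addrACA. Qed.

Lemma alg_assocN1 u x y : ⟨- u, x, y⟩ = - ⟨u, x, y⟩.
Proof. by rewrite /alg_assoc !linearNl opprD. Qed.

Lemma alg_assocN2 x u y : ⟨x, - u, y⟩ = - ⟨x, u, y⟩.
Proof. by rewrite /alg_assoc linearNr !linearNl linearNr opprD. Qed.

Lemma alg_assocN3 x y u : ⟨x, y, - u⟩ = - ⟨x, y, u⟩.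
Proof. by rewrite /alg_assoc !linearNr opprD. Qed.

Lemma in_nucleusD u v : in_nucleus u -> in_nucleus v -> in_nucleus (u + v).
Proof.
move=> Nu Nv x y; case: (Nu x y) (Nv x y) => [u1 u2 u3] [v1 v2 v3].
by rewrite alg_assocD1 alg_assocD2 alg_assocD3 u1 u2 u3 v1 v2 v3 addr0.
Qed.

Lemma in_nucleusN u : in_nucleus u -> in_nucleus (- u).
Proof.
move=> Nu x y; case: (Nu x y) => [u1 u2 u3].
by rewrite alg_assocN1 alg_assocN2 alg_assocN3 u1 u2 u3 oppr0.
Qed.

Lemma teichmuller w x y z :
  w · ⟨x, y, z⟩ + ⟨w, x, y⟩ · z = ⟨w · x, y, z⟩ - ⟨w, x · y, z⟩ + ⟨w, x, y · z⟩.
Proof.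
rewrite /alg_assoc !linearBl !linearBr.
set a := w · (x · y · z); set b := w · (x · (y · z)).
set c := w · x · y · z; set d := w · (x · y) · z; set e := w · x · (y · z).
rewrite opprB [RHS]addrAC (addrA (c - e)) subrK.
by rewrite addrACA [RHS]addrACA (addrC a).
Qed.

(** Associators and their right multiples already span a two-sided ideal once associators are
    nuclear, so closure under products need not be built in. *)
Inductive assoc_ideal : V -> Prop :=
| assoc_ideal0 : assoc_ideal 0
| assoc_idealP a u v :
    assoc_ideal u -> assoc_ideal v -> assoc_ideal (a *: u + v)
| assoc_ideal_gen x y z : assoc_ideal ⟨x, y, z⟩
| assoc_ideal_genr x y z r : assoc_ideal (⟨x, y, z⟩ · r).

Lemma assoc_idealD u v : assoc_ideal u -> assoc_ideal v -> assoc_ideal (u + v).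
Proof. by move=> Iu Iv; rewrite -[u]scale1r; apply: assoc_idealP. Qed.

Lemma assoc_idealN u : assoc_ideal u -> assoc_ideal (- u).
Proof.
by move=> Iu; rewrite -scaleN1r -[_ *: _]addr0; apply/assoc_idealP/assoc_ideal0.
Qed.

Hypothesis assocN : forall x y z, in_nucleus ⟨x, y, z⟩.

Lemma mul_nucl n x y : in_nucleus n -> n · x · y = n · (x · y).
Proof. by move=> Nn; case: (Nn x y) => /subr0_eq. Qed.

Lemma mul_nucm x n y : in_nucleus n -> x · n · y = x · (n · y).
Proof. by move=> Nn; case: (Nn x y) => _ /subr0_eq. Qed.

Lemma alg_assoc_nucl n x y z : in_nucleus n -> ⟨n · x, y, z⟩ = n · ⟨x, y, z⟩.
Proof. by move=> Nn; rewrite /alg_assoc linearBr !(mul_nucl _ _ Nn). Qed.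

Lemma alg_assoc_nucr n x y z : in_nucleus n -> ⟨x, y, z · n⟩ = ⟨x, y, z⟩ · n.
Proof.
move=> Nn; have nr u v : u · v · n = u · (v · n).
  by case: (Nn u v) => _ _ /subr0_eq.
by rewrite /alg_assoc linearBl !nr.
Qed.

Lemma alg_assoc_nuclm n x y z : in_nucleus n -> ⟨x · n, y, z⟩ = ⟨x, n · y, z⟩.
Proof. by move=> Nn; rewrite /alg_assoc !(mul_nucm _ _ Nn) (mul_nucl _ _ Nn). Qed.

Lemma alg_assoc_nucmr n x y z : in_nucleus n -> ⟨x, y · n, z⟩ = ⟨x, y, n · z⟩.
Proof.
move=> Nn; have [_ _ /subr0_eq E] := Nn x y.
by rewrite /alg_assoc -(mul_nucm (x · y) _ Nn) E (mul_nucm y _ Nn).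
Qed.

(** The other side of the Teichmüller identity is a signed sum of associators. *)
Lemma teichmuller_nucleus w x y z : in_nucleus (w · ⟨x, y, z⟩ + ⟨w, x, y⟩ · z).
Proof.
by rewrite teichmuller; do 2?apply: in_nucleusD => //; apply: in_nucleusN.
Qed.

(** The inner associator slides from [⟨x, y, z⟩] over [⟨y, z, r⟩] to [⟨z, r, s⟩]: each shift costs a
    sign, because a Teichmüller sum is nuclear, and between shifts a nuclear factor crosses a
    comma. *)
Lemma alg_assoc_mul2 w x y z r s : (⟨w, x, y⟩ · ⟨z, r, s⟩) *+ 2 = 0.
Proof.
set c := ⟨w, x, y⟩; set d := ⟨z, r, s⟩.
have E1 : ⟨w · ⟨x, y, z⟩, r, s⟩ = - (c · d).
  have [E _ _] := teichmuller_nucleus w x y z r s.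
  apply/esym/addr0_eq; rewrite -E alg_assocD1 addrC.
  by rewrite (alg_assoc_nucl _ _ _ (assocN w x y)).
have E2 : ⟨w, ⟨x, y, z⟩ · r, s⟩ = - ⟨w, x · ⟨y, z, r⟩, s⟩.
  have [_ E _] := teichmuller_nucleus x y z r w s.
  by apply/esym/addr0_eq; rewrite -E alg_assocD2.
have E3 : ⟨w, x, ⟨y, z, r⟩ · s⟩ = - ⟨w, x, y · d⟩.
  have [_ _ E] := teichmuller_nucleus y z r s w x.
  by apply/esym/addr0_eq; rewrite -E alg_assocD3.
(* The chain is [- (c · d) = ⟨w · ⟨x, y, z⟩, r, s⟩ = - ⟨w, x · ⟨y, z, r⟩, s⟩ = ⟨w, x, y · d⟩ = c ·
   d]. *)
move: E1; rewrite alg_assoc_nuclm // E2 alg_assoc_nucmr // E3 opprK.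
rewrite (alg_assoc_nucr _ _ _ (assocN z r s)) => E.
by rewrite mulr2n {2}E subrr.
Qed.

Lemma assoc_idealMr u r : assoc_ideal u -> assoc_ideal (u · r).
Proof.
elim=> [|a u1 v1 _ Iu _ Iv|x y z|x y z t].
- by rewrite linear0l; apply: assoc_ideal0.
- by rewrite linearPl; apply: assoc_idealP.
- exact: assoc_ideal_genr.
- by rewrite mul_nucl //; apply: assoc_ideal_genr.
Qed.

Lemma assoc_idealMl u r : assoc_ideal u -> assoc_ideal (r · u).
Proof.
(* Teichmüller turns a left multiple of an associator into associators minus the right multiple
   [⟨r, x, y⟩ · z]. *)
have Igen x y z : assoc_ideal (r · ⟨x, y, z⟩).
  rewrite -[_ · _](addrK (⟨r, x, y⟩ · z)) teichmuller.
  apply: assoc_idealD; last exact/assoc_idealN/assoc_ideal_genr.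
  apply: assoc_idealD; last exact: assoc_ideal_gen.
  apply: assoc_idealD; first exact: assoc_ideal_gen.
  exact/assoc_idealN/assoc_ideal_gen.
elim=> [|a u1 v1 _ Iu _ Iv|x y z|x y z t].
- by rewrite linear0r; apply: assoc_ideal0.
- by rewrite linearPr; apply: assoc_idealP.
- exact: Igen.
- by rewrite -mul_nucm //; apply: assoc_idealMr.
Qed.

Lemma assoc_ideal_sq0 u v :
  2%N \notin [pchar F] -> assoc_ideal u -> assoc_ideal v -> u · v = 0.
Proof.
move=> charF Iu.
have gen0 w x y z r s : ⟨w, x, y⟩ · ⟨z, r, s⟩ = 0.
  apply/eqP; have /eqP := alg_assoc_mul2 w x y z r s.
  by rewrite -scaler_nat scaler_eq0 => /orP[F2|//]; rewrite inE F2 in charF.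
have genI0 x y z t : assoc_ideal t -> ⟨x, y, z⟩ · t = 0.
  elim=> [|a u1 v1 _ Eu _ Ev|//|x1 y1 z1 r].
  - by rewrite linear0r.
  - by rewrite linearPr /= Eu Ev scaler0 addr0.
  - by rewrite -mul_nucl // gen0 linear0l.
elim: Iu v => [|a u1 v1 _ Eu _ Ev|x y z|x y z t] v Iv.
- by rewrite linear0l.
- by rewrite linearPl /= Eu // Ev // scaler0 addr0.
- exact: genI0.
(* Nuclearity moves the bracket to [t · v], which lies in the ideal and so is killed by
   associators. *)
- by rewrite mul_nucl // genI0 //; apply: assoc_idealMl.
Qed.

End AssociatorIdeal.

Arguments alg_assoc {F V} m x y z.
Arguments in_nucleus {F V} m n.
Arguments assoc_ideal {F V} m _.

(** * The split algebra of a 0-dialgebra *)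

Section SplitAlgebra.

Variables (F : fieldType) (D : dialgebra F).
Local Open Scope dialgebra_scope.
Local Open Scope classical_set_scope.

(** This is the split null extension of [D] under [⊢] by a second copy of [D], acted on by [⊢] from
    the left and by [⊣] from the right. *)
Definition split_mul (x y : (D * D)%type) : (D * D)%type :=
  (x.1 ⊢ y.1, x.1 ⊢ y.2 + x.2 ⊣ y.1).

Lemma split_mul_bilinear : bilinear_for
  (GRing.Scale.Law.clone _ _ *:%R _) (GRing.Scale.Law.clone _ _ *:%R _)
  split_mul.
Proof.
split=> [[u1 u2] a [x1 x2] [y1 y2]|[u1 u2] a [x1 x2] [y1 y2]] /=;
  apply/pair_equal_spec; split => /=; rewrite ?linearPl ?linearPr //= scalerDr;
  by rewrite addrACA.
Qed.

HB.instance Definition _ := bilinear_isBilinear.Build F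
  (D * D)%type (D * D)%type (D * D)%type _ _ split_mul split_mul_bilinear.

Lemma associatorD1 k u v x y :
  associator D k (u + v) x y = associator D k u x y + associator D k v x y.
Proof. by case: k; rewrite /associator !linearDl opprD addrACA. Qed.

Lemma associatorD2 k x u v y :
  associator D k x (u + v) y = associator D k x u y + associator D k x v y.
Proof.
by case: k; rewrite /associator linearDr !linearDl linearDr opprD addrACA.
Qed.

Lemma associatorD3 k x y u v :
  associator D k x y (u + v) = associator D k x y u + associator D k x y v.
Proof. by case: k; rewrite /associator !linearDr opprD addrACA. Qed.

Lemma dinucleusD u v : dinucleus D u -> dinucleus D v -> dinucleus D (u + v).
Proof.
move=> Nu Nv k x y; case: (Nu k x y) (Nv k x y) => [u1 u2 u3] [v1 v2 v3].
by rewrite associatorD1 associatorD2 associatorD3 u1 u2 u3 v1 v2 v3 addr0.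
Qed.

Local Arguments associator : simpl never.

Hypothesis D0 : zero_dialgebra D.

Lemma split_assocE (x y z : (D * D)%type) :
  alg_assoc split_mul x y z =
  (associator D RightAssoc x.1 y.1 z.1,
   associator D RightAssoc x.1 y.1 z.2 + associator D InnerAssoc x.1 y.2 z.1
   + associator D LeftAssoc x.2 y.1 z.1).
Proof.
apply/pair_equal_spec; split => //=.
(* The product yields [x.2 ⊣ (y.1 ⊢ z.1)]; the bar identity turns it into the term of a left
   associator. *)
by rewrite linearDl linearDr -D0.2 addrA opprD addrACA opprD; congr (_ + _);
   rewrite addrACA.
Qed.

Lemma split_assoc_nucleus :
  (forall k (x y z : D), dinucleus D (associator D k x y z)) ->
  forall x y z, in_nucleus split_mul (alg_assoc split_mul x y z).
Proof.
move=> DN x y z; rewrite split_assocE.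
set n1 := associator D RightAssoc _ _ _; set n2 := (X in (_, X)).
have N1 : dinucleus D n1 by apply: DN.
have N2 : dinucleus D n2.
  by apply: dinucleusD; [apply: dinucleusD|]; apply: DN.
move=> u v; rewrite !split_assocE /=.
have Z1 k a b : associator D k n1 a b = 0 by case: (N1 k a b).
have Z2 k a b : associator D k a n1 b = 0 by case: (N1 k a b).
have Z3 k a b : associator D k a b n1 = 0 by case: (N1 k a b).
have Z4 k a b : associator D k n2 a b = 0 by case: (N2 k a b).
have Z5 k a b : associator D k a n2 b = 0 by case: (N2 k a b).
have Z6 k a b : associator D k a b n2 = 0 by case: (N2 k a b).
by rewrite !Z1 !Z2 !Z3 Z4 Z5 Z6 !addr0.
Qed.

(* By the bar identities, [a ⊢ b] and [a ⊣ b] are always related. *)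
Definition bar_equiv (x y : D) : Prop :=
  forall z : D, x ⊢ z = y ⊢ z /\ z ⊣ x = z ⊣ y.

(* The witness [y] stands for [x] in the first component: the left and right
   associators of the same three elements differ in [D], but are equivalent. *)
Definition split_ideal : set D :=
  [set x | assoc_ideal split_mul (0, x) /\
           exists2 y, assoc_ideal split_mul (y, 0) & bar_equiv x y].

Lemma bar_equiv_linear a x y x' y' :
  bar_equiv x x' -> bar_equiv y y' -> bar_equiv (a *: x + y) (a *: x' + y').
Proof.
move=> ex ey z; case: (ex z) (ey z) => [xl xr] [yl yr].
by rewrite !linearPl !linearPr /= xl xr yl yr.
Qed.

Lemma split_ideal_di_ideal :
  (forall k (x y z : D), dinucleus D (associator D k x y z)) ->
  di_ideal split_ideal.
Proof.
move=> DN; have sN := split_assoc_nucleus DN.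
have [barl barr] := D0.
split; first split.
- rewrite inE; split; first exact: assoc_ideal0.
  by exists 0; first exact: assoc_ideal0.
- move=> a x y; rewrite !inE => -[Ix [x' Ix' ex]] [Iy [y' Iy' ey]].
  split.
    have -> : (0, a *: x + y) = a *: (0, x) + (0, y) :> (D * D)%type.
      by apply: injective_projections; rewrite /= ?scaler0 ?addr0.
    exact: assoc_idealP.
  exists (a *: x' + y'); last exact: bar_equiv_linear.
  have -> : (a *: x' + y', 0) = a *: (x', 0) + (y', 0) :> (D * D)%type.
    by apply: injective_projections; rewrite /= ?scaler0 ?addr0.
  exact: assoc_idealP.
move=> x d [Ix [y Iy exy]].
have IMr u v : assoc_ideal split_mul u -> assoc_ideal split_mul (split_mul u v).
  exact: (assoc_idealMr sN).
have IMl u v : assoc_ideal split_mul u -> assoc_ideal split_mul (split_mul v u).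
  exact: (assoc_idealMl sN).
have Iyd : assoc_ideal split_mul (y ⊢ d, 0).
  have := IMr _ (d, 0) Iy.
  by rewrite /split_mul /= linear0r linear0l addr0.
have Idy : assoc_ideal split_mul (d ⊢ y, 0).
  have := IMl _ (d, 0) Iy.
  by rewrite /split_mul /= linear0r linear0l addr0.
have [exd edx] : x ⊢ d = y ⊢ d /\ d ⊣ x = d ⊣ y by apply: exy.
(* The products [x ⊣ d] and [d ⊢ x] come from multiplying [(0, x)] by [(d, 0)]; [x ⊢ d = y ⊢ d] and
   [d ⊣ x = d ⊣ y] come from multiplying [(y, 0)] by [(0, d)]. *)
split; split.
- have := IMr _ (d, 0) Ix.
  by rewrite /split_mul /= !linear0l add0r.
- by exists (y ⊢ d) => // z; rewrite -exd barl barr.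
- have := IMr _ (0, d) Iy.
  by rewrite /split_mul /= linear0r linear0l addr0 exd.
- by exists (y ⊢ d) => // z; rewrite exd.
- have := IMl _ (0, d) Iy.
  by rewrite /split_mul /= !linear0l add0r edx.
- exists (d ⊢ y) => // z; rewrite edx.
  by rewrite barl barr.
- have := IMl _ (d, 0) Ix.
  by rewrite /split_mul /= linear0r linear0l addr0.
- exists (d ⊢ y) => // z.
  by rewrite -!barl -!barr edx.
Qed.

Lemma split_ideal_gen k (x y z : D) : split_ideal (associator D k x y z).
Proof.
have [barl barr] := D0.
have gen u v w := assoc_ideal_gen split_mul u v w.
split.
  case: k; [ have := gen (0, x) (y, 0) (z, 0) | have := gen (x, 0) (0, y) (z, 0)
           | have := gen (x, 0) (y, 0) (0, z) ];
    rewrite split_assocE // /associator /=;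
    by rewrite !(linear0l, linear0r, oppr0, add0r, addr0).
(* One witness serves all three kinds, since by the bar identities they act alike from the
   outside. *)
exists (associator D RightAssoc x y z).
  have := gen (x, 0) (y, 0) (z, 0).
  rewrite split_assocE // /associator /=.
  by rewrite !(linear0l, linear0r, oppr0, addr0).
move=> t; case: k; rewrite /associator !linearBl !linearBr; split=> //;
  congr (_ - _).
- by rewrite !barl.
- by rewrite barr barl.
- by rewrite barr barl.
- by rewrite (barr x) barr.
- by rewrite barl.
- by rewrite -barl barr barl.
- by rewrite barr.
- by rewrite -barr (barr x) barr.
Qed.

End SplitAlgebra.

Theorem theorem6p8 (F : fieldType) (D : dialgebra F)
    (charF : 2%N \notin [pchar F])
    (D0 : zero_dialgebra D)
    (Dsemiprime : semiprime_dialgebra D)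
    (Dassoc : forall (k : assoc_kind) (x y z : D),
       dinucleus D (associator D k x y z)) :
  associative_dialgebra D.
Proof.
have sN := split_assoc_nucleus D0 Dassoc.
have I0 : @split_ideal F D = [set 0]%classic.
  apply: Dsemiprime; first exact: split_ideal_di_ideal.
  (* Here [(0, a)] times [(b', 0)] is zero, with second component [a ⊣ b' = a ⊣ b]; the case of [⊢]
     uses [(a', 0)] times [(0, b)]. *)
  - move=> a b [Ia _] [_ [b' Ib' eb]].
    have /(congr1 snd) := assoc_ideal_sq0 sN charF Ia Ib'.
    by rewrite /= linear0l add0r (eb a).2.
  - move=> a b [_ [a' Ia' ea]] [Ib _].
    have /(congr1 snd) := assoc_ideal_sq0 sN charF Ia' Ib.
    by rewrite /= linear0l addr0 (ea b).1.
split=> // k x y z; have := split_ideal_gen D0 k x y z.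
by rewrite I0.
Qed.
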